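(* Let $G$ be a countably infinite group with identity $e$ and let $A\subseteq G$ satisfy $A=A^{-1}$ and $e\in A$. Then there exists $X\subseteq G$ such that $\Delta(X)=A$ and $X\cap gX\neq\varnothing$ for every $g\in G$.
   Context: For $X\subseteq G$, $\Delta(X)=\{g\in G:|gX\cap X|=\infty\}$. *)

(* Defs.v *)
From mathcomp Require Import all_boot.
From mathcomp Require Import boolp classical_sets functions cardinality.

Set Implicit Arguments.
Unset Strict Implicit.
Unset Printing Implicit Defensive.

Local Open Scope classical_set_scope.
Local Open Scope group_scope.

Definition ltranslate (G : groupType) (g : G) (X : set G) : set G :=
  [set g * x | x in X].

Definition Delta (G : groupType) (X : set G) : set G :=
  [set g | infinite_set (ltranslate g X `&` X)].

(* Main.v *)
(** Take X to be a union of pairs {x_n, h_n x_n}, where h_n enumerates all of G,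
    taking each value of A infinitely often and every other value only once, and
    where x_n is chosen outside the finite set of points that would create an
    early element of G as a quotient between the n-th pair and a previous one.
    A fixed g is then a quotient of elements of distinct pairs only finitely
    often, so g X meets X in an infinite set exactly when h_n is g or g^-1
    infinitely often, or when g is 1. *)
Require Import Defs.
From mathcomp Require Import all_boot.
From mathcomp Require Import boolp classical_sets functions cardinality.

Local Open Scope classical_set_scope.
Local Open Scope group_scope.

Lemma infinite_notin_seq (T : eqType) (s : seq T) :
  infinite_set [set: T] -> exists x, x \notin s.
Proof.
move=> /infinite_setD/(_ (finite_seq s))/infinite_setN0[x [_ xs]].
by exists x; apply/negP.
Qed.

Lemma countable_exhausting_seqs (T : eqType) : countable [set: T] ->
  exists F : nat -> seq T, forall x, exists N, forall n, N <= n -> x \in F n.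
Proof.
move=> /countable_injP[f finj].
have /choice[F FP] : forall n, exists s : seq T, [set x | f x < n] = [set` s].
  move=> n; apply/finite_seqP/(@finite_preimage _ _ `I_n f) => [x y _ _|].
    by apply: finj; rewrite in_setT.
  exact: finite_II.
exists F => x; exists (f x).+1 => n lt_fx_n.
by have : [set` F n] x by rewrite -FP.
Qed.

(** Here [s n] is the history of points chosen before stage [n]. A choice [p] is fixed in advance
    for every pair (stage, history), so plain recursion on the history suffices. *)
Lemma avoiding_sequence {T : eqType} (B : nat -> seq T -> seq T) :
    infinite_set [set: T] ->
  exists (x : nat -> T) (s : nat -> seq T),
    (forall n, x n \notin B n (s n)) /\ (forall m n, m < n -> x m \in s n).
Proof.
move=> infT.
have /choice[p pP] (a : nat * seq T) : exists x, x \notin B a.1 a.2.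
  exact: infinite_notin_seq.
pose s := fix s n := if n is m.+1 then p (m, s m) :: s m else [::].
exists (fun n => p (n, s n)), s; split=> [n|m]; first exact: (pP (n, s n)).
elim=> // n IHn; rewrite ltnS leq_eqVlt inE => /predU1P[->|/IHn ->].
  by rewrite eqxx.
by rewrite orbT.
Qed.

(** A coincidence can be solved for [x n]: it forces [x n = u^-1 * (g * v) * x m], which lies in a
    finite list known at stage [n] once [g] has entered [F n]. *)
Lemma generic_pairs {G : groupType} (h : nat -> G) :
    countable [set: G] -> infinite_set [set: G] ->
  exists x : nat -> G, forall g, exists N, forall n m u v,
    N <= n -> m < n -> u \in [:: 1; h n] -> v \in [:: 1; h m] ->
    u * x n <> g * (v * x m).
Proof.
move=> /countable_exhausting_seqs[F FP] infG.
pose K n := [seq f * v | f <- F n, v <- 1 :: [seq h m | m <- iota 0 n]].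
pose L n s := [seq k * y | k <- K n, y <- s].
pose B n s := [seq u^-1 * l | u <- [:: 1; h n], l <- L n s].
have [x [s [xB xs]]] := avoiding_sequence B infG.
exists x => g; have [N NP] := FP g; exists N => n m u v Nn mn un vm eq_ux.
have /negP := xB n; apply.
have -> : x n = u^-1 * ((g * v) * x m) by rewrite -mulgA -eq_ux mulKg.
do 3?[apply: allpairs_f] => //; [exact: NP| |exact: xs].
move: vm; rewrite !inE => /orP[->//|/eqP->].
by rewrite map_f ?orbT// mem_iota.
Qed.

(** Pairs [(t, j)] are coded injectively by naturals and [h] decodes them: [j = 0] serves every [t]
    once, while [j > 0] gives repetitions to members of [A] only. *)
Lemma prescribed_multiplicities {T : Type} (A : set T) : countable [set: T] ->
    A !=set0 ->
  exists h : nat -> T,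
    [/\ forall t, exists n, h n = t,
        forall a, A a -> infinite_set [set n | h n = a] &
        forall t, ~ A t -> exists N, forall n, h n = t -> n < N].
Proof.
move=> /countable_injP[f finj] [a0 Aa0].
pose c t j := pickle (f t, j : nat).
have c_inj t j t' j' : c t j = c t' j' -> t = t' /\ j = j'.
  move=> /(pcan_inj pickleK)[+ ->]; split=> //.
  by apply: finj => //; rewrite in_setT.
have /choice[h hP] n : exists t,
    (forall t' j, c t' j = n -> j = 0 \/ A t' -> t = t') /\ (A t \/ c t 0 = n).
  have [[t [j [ctn tj]]]|none] :=
      pselect (exists t j, c t j = n /\ (j = 0 \/ A t)).
    exists t; split=> [t' j' ct'n _|].
      by have [] := c_inj t j t' j' (etrans ctn (esym ct'n)).
    by case: tj => [<-|]; [right|left].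
  (* Naturals that code no admissible pair get [a0], whose multiplicity is not bounded. *)
  by exists a0; split; [move=> t j ctn tj; case: none; exists t, j | left].
exists h; split=> [t|a Aa|t nAt].
- by exists (c t 0); have [+ _] := hP (c t 0); apply; [|left].
- apply: (@sub_infinite_set _ [set c a j | j in [set: nat]]) => [_ [j _ <-]|].
    by have [+ _] := hP (c a j); apply; [|right].
  move=> /finite_preimage => /(_ _ (c a)) fin; apply: infinite_nat.
  apply: sub_finite_set (fin _) => [j _|i j _ _ /c_inj[]//].
  by exists j.
- by exists (c t 0).+1 => n hn; have [_ []] := hP n; rewrite hn// => ->.
Qed.

Theorem theorem5p3 (G : groupType)
    (countG : countable [set: G]) (infG : infinite_set [set: G])
    (A : set G) (symA : A = [set a^-1 | a in A]) (A1 : A 1) :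
  exists X : set G,
    Delta X = A /\ forall g : G, X `&` ltranslate g X !=set0.
Proof.
have AV a : A a^-1 -> A a by move=> AaV; rewrite symA; exists a^-1; rewrite ?invgK.
have [h [h_onto h_inf h_fin]] :=
  prescribed_multiplicities A countG (ex_intro _ 1 A1).
have [x xP] := generic_pairs h countG infG.
pose X : set G := [set z | exists n u, u \in [:: 1; h n] /\ z = u * x n].
have Xx n : X (x n) by exists n, 1; rewrite mul1g inE eqxx.
have Xhx n : X (h n * x n) by exists n, (h n); rewrite !inE eqxx orbT.
exists X; split; last first.
  move=> g; have [n <-] := h_onto g.
  by exists (h n * x n); split=> //; exists (x n).
apply/seteqP; split=> g; last first.
  move=> /h_inf inf_hg fin.
  (* Genericity at [1] makes [x] injective from [N] on, so infinitely many indices yield infinitely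
     many points. *)
  have [N NP] := xP 1.
  have x_inj n m : N <= n -> x n = x m -> ~ m < n.
    move=> Nn xnm mn; apply: (NP n m 1 1 Nn mn); rewrite ?inE ?eqxx//.
    by rewrite !mul1g.
  apply: (infinite_setD inf_hg (finite_II N)).
  pose D := [set n | h n = g] `\` `I_N.
  have x_injD : {in D &, injective x}.
    move=> n m; rewrite !inE => -[_ /negP +] [_ /negP +] xnm.
    rewrite /= -!leqNgt => Nn Nm; case: (ltngtP n m) => // [nm|mn].
      by case: (x_inj m n Nm (esym xnm)).
    by case: (x_inj n m Nn xnm).
  rewrite -(eq_finite_set (inj_card_eq x_injD)).
  apply: sub_finite_set (finite_image (fun z => g^-1 * z) fin).
  move=> _ [n [hng _] <-]; exists (g * x n); last by rewrite mulKg.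
  by split; [exists (x n) | rewrite -hng].
apply: contra_notP => nAg.
have nAgV : ~ A g^-1 by move=> /AV.
(* Either index of a coincidence may be the larger; the inverse covers the case where the translated
   point is the later one. *)
have [N1 N1P] := xP g; have [N2 N2P] := xP g^-1.
have [N3 N3P] := h_fin g nAg; have [N4 N4P] := h_fin g^-1 nAgV.
pose N := maxn (maxn N1 N2) (maxn N3 N4).
apply: (@sub_finite_set _ _
  [set` [seq x n | n <- iota 0 N] ++ [seq h n * x n | n <- iota 0 N]]);
  last exact: finite_seq.
move=> _ [[_ [m [v [vm ->]]] <-] [n [u [un eq_vu]]]] /=.
have nN : n < N.
  rewrite ltnNge /N !geq_max; apply/negP => /andP[/andP[N1n N2n] /andP[N3n N4n]].
  case: (ltngtP n m) => [nm|mn|nm].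
  - apply: (N2P m n v u) => //; first exact: leq_trans N2n (ltnW nm).
    by rewrite -eq_vu mulKg.
  - exact: (N1P n m u v).
  (* Within one pair [x n] cancels, leaving [g] equal to [1], [h n] or [(h n)^-1]. *)
  - subst m; move: eq_vu; rewrite mulgA => /mulIg.
    move: un vm; rewrite !inE => /orP[]/eqP-> /orP[]/eqP->; rewrite ?mulg1.
    + by move=> g1; apply: nAg; rewrite g1.
    + by move=> /mulg1_eq ghn; move: N4n; rewrite leqNgt N4P.
    + by move=> ghn; move: N3n; rewrite leqNgt N3P.
    + by rewrite -{2}[h n]mul1g => /mulIg g1; apply: nAg; rewrite g1.
rewrite mem_cat; move: un; rewrite eq_vu !inE => /orP[]/eqP->.
  by rewrite mul1g map_f ?mem_iota.
by rewrite orbC (map_f (fun n => h n * x n)) ?mem_iota.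
Qed.
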